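(* Let $\mathcal{H}$ be a separable complex Hilbert space and let $T \in B(\mathcal{H})$ be a partial isometry. (i) If $\dim \ker T = \dim \ker T^* \leq 1$, then $T$ is a complex symmetric operator. (ii) If $\dim \ker T \neq \dim \ker T^*$, then $T$ is not a complex symmetric operator. (iii) For each $n$ with $2 \leq n \leq \infty$, there exist partial isometries $T$ (on separable complex Hilbert spaces) with $\dim \ker T = \dim \ker T^* = n$ that are complex symmetric, and there also exist partial isometries $T$ with $\dim \ker T = \dim \ker T^* = n$ that are not complex symmetric.
   Context: A partial isometry is an operator $T$ such that $T^*T$ is an orthogonal projection. A conjugation on $\mathcal{H}$ is a conjugate-linear map $C:\mathcal{H}\to\mathcal{H}$ that is isometric and involutive ($C^2=I$). An operator $T$ is complex symmetric if $T = CT^*C$ for some conjugation $C$. *)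

(* Defs.v *)
(* MathComp 2.5 + mathcomp-reals + mathcomp-real-closed (complex). *)
From HB Require Import structures.
From mathcomp Require Import all_boot all_order all_algebra.
From mathcomp Require Import reals.
From mathcomp Require Import complex.
Set Implicit Arguments. Unset Strict Implicit. Unset Printing Implicit Defensive.
Import Order.TTheory GRing.Theory Num.Theory.
Local Open Scope ring_scope.
Local Open Scope complex_scope.

(* Scalars: the complex numbers R[i] over a real field R : realType
   (a complete archimedean ordered field, i.e. a copy of the reals).
   A complex Hilbert space is a complex vector space V together with an
   inner product ip (linear in the first variable, conjugate-symmetric,
   positive definite) which is complete for the induced norm. *)

Section Hilbert.
Variable R : realType.
Variable V : lmodType R[i].
Variable ip : V -> V -> R[i].

(* squared norm ||x||^2 = <x, x> (a nonnegative real) *)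
Definition sqnorm (x : V) : R := complex.Re (ip x x).

Definition inner_product : Prop :=
  [/\ (forall (a : R[i]) (x y z : V), ip (a *: x + y) z = a * ip x z + ip y z),
      (forall x y : V, ip y x = (ip x y)^*),
      (forall x : V, 0 <= ip x x) &
      (forall x : V, ip x x = 0 -> x = 0)].

Definition cauchy_seq (u : nat -> V) : Prop :=
  forall e : R, 0 < e -> exists N : nat, forall m n : nat,
    (N <= m)%N -> (N <= n)%N -> sqnorm (u m - u n) < e.

Definition converges_to (u : nat -> V) (l : V) : Prop :=
  forall e : R, 0 < e -> exists N : nat, forall n : nat,
    (N <= n)%N -> sqnorm (u n - l) < e.

Definition complete_space : Prop :=
  forall u : nat -> V, cauchy_seq u -> exists l : V, converges_to u l.

Definition separable_space : Prop :=
  exists d : nat -> V, forall (x : V) (e : R), 0 < e ->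
    exists n : nat, sqnorm (x - d n) < e.

(* (V, ip) is a separable complex Hilbert space *)
Definition separable_hilbert : Prop :=
  [/\ inner_product, complete_space & separable_space].

(* linear operators, bounded operators *)
Definition linear_op (T : V -> V) : Prop :=
  forall (a : R[i]) (x y : V), T (a *: x + y) = a *: T x + T y.

Definition bounded_op (T : V -> V) : Prop :=
  linear_op T /\ exists M : R, forall x : V, sqnorm (T x) <= M * sqnorm x.

(* S is the (Hilbert space) adjoint T^* of T *)
Definition is_adjoint (T S : V -> V) : Prop :=
  forall x y : V, ip (T x) y = ip x (S y).

(* orthogonal projection: idempotent and self-adjoint *)
Definition orth_projection (P : V -> V) : Prop :=
  (forall x, P (P x) = P x) /\ is_adjoint P P.

(* T is a partial isometry (Tadj being T^* ): T^* T is an orthogonal projection *)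
Definition partial_isometry (T Tadj : V -> V) : Prop :=
  orth_projection (fun x => Tadj (T x)).

(* conjugation: conjugate-linear, isometric, involutive *)
Definition conjugation (C : V -> V) : Prop :=
  [/\ (forall (a : R[i]) (x y : V), C (a *: x + y) = a^* *: C x + C y),
      (forall x : V, sqnorm (C x) = sqnorm x) &
      (forall x : V, C (C x) = x)].

(* T is complex symmetric: T = C T^* C for some conjugation C *)
Definition complex_symmetric (T Tadj : V -> V) : Prop :=
  exists C : V -> V, conjugation C /\ forall x : V, T x = C (Tadj (C x)).

Definition kernel (T : V -> V) : V -> Prop := fun x => T x = 0.

(* K contains an orthonormal family of n vectors *)
Definition has_orthonormal (K : V -> Prop) (n : nat) : Prop :=
  exists e : 'I_n -> V, (forall i, K (e i)) /\
    forall i j : 'I_n, ip (e i) (e j) = (i == j)%:R.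
End Hilbert.

(* Hilbert dimensions of subspaces of a separable Hilbert space:
   0, 1, 2, ..., or infinity (= aleph_0). *)
Inductive hdim := Fin of nat | Inf.

Definition dim_is (R : realType) (V : lmodType R[i]) (ip : V -> V -> R[i])
    (K : V -> Prop) (d : hdim) : Prop :=
  match d with
  | Fin n => has_orthonormal ip K n /\ ~ has_orthonormal ip K n.+1
  | Inf => forall n : nat, has_orthonormal ip K n
  end.

Definition hdim_le1 (d : hdim) : Prop :=
  match d with Fin n => (n <= 1)%N | Inf => False end.

Definition hdim_ge2 (d : hdim) : Prop :=
  match d with Fin n => (2 <= n)%N | Inf => True end.

(* Main.v *)
(* For (i), let U be T completed to a unitary by sending a unit vector e of
   ker T to a unit vector f of ker T^* (e = f = 0 if the kernels vanish). The
   space is the closed span of mutually orthogonal U-orbits, one of them that of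
   e, and the antilinear map C : U^k a |-> U^(1-k) a is a conjugation with
   C U^* C = U and C e = f, whence C T^* C = T. No spectral theorem is needed.
   For (ii), C maps ker T onto ker T^*. For (iii), on l^2 of an initial segment
   of the naturals, the zero operator is complex symmetric, while
   u_0 |-> u_1 |-> (3/5) u_2 + (4/5) u_3, u_2 |-> u_4, u_k |-> 0 otherwise,
   is not. *)
Require Import Defs.
From HB Require Import structures.
From mathcomp Require Import all_boot all_order all_algebra.
From mathcomp Require Import reals.
From mathcomp Require Import complex.
From mathcomp Require Import boolp classical_sets functions.
From mathcomp Require Import topology normedtype sequences.
From mathcomp Require Import ring lra zify.
Import Order.TTheory GRing.Theory Num.Theory.
Import numFieldNormedType.Exports.
Local Open Scope ring_scope.
Local Open Scope complex_scope.
Set Implicit Arguments.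
Unset Strict Implicit.
Unset Printing Implicit Defensive.

(** The spectral theorem would realize a unitary as a multiplication operator, with complex
    conjugation of functions as [C]. Orbit reversal can replace it because [<U^j a, U^k a>] depends
    only on [j - k], so that reversing an orbit conjugates its Gram matrix. An orbit may be linearly
    dependent and need not be orthogonal within itself, so [C] cannot simply be prescribed on a
    basis: it is the closure of a relation between finite combinations, and isometry makes this
    relation total and single-valued. Every reflection [k |-> c - k] would give [C U^* C = U]; the
    choice [c = 1] gives [C e = U e = f], which makes the rank-one corrections of [U^*] and [U]
    correspond as well. The counterexample has rank 3 and involves five basis vectors, whence
    kernels of dimension at least 2. The fractions come from the triangle with sides 3, 4, 5. *)

Section ComplexNumbers.
Variable R : realType.
Implicit Types z w : R[i].

Definition sqmod z : R := complex.Re z ^+ 2 + complex.Im z ^+ 2.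

Lemma sqmod_ge0 z : 0 <= sqmod z.
Proof. by rewrite addr_ge0 ?sqr_ge0. Qed.

Lemma sqmodE z : z * z^*%C = (sqmod z)%:C.
Proof. by case: z => a b; congr (_ +i* _); rewrite /sqmod /=; ring. Qed.

Lemma sqmod_eq0 z : sqmod z = 0 -> z = 0.
Proof.
case: z => a b /eqP; rewrite /sqmod /= paddr_eq0 ?sqr_ge0 // !sqrf_eq0.
by case/andP => /eqP-> /eqP->.
Qed.

Lemma sqmodD_le z w : sqmod (z + w) <= 2 * sqmod z + 2 * sqmod w.
Proof.
case: z w => [p q] [p' q']; rewrite /sqmod /=.
by have := sqr_ge0 (p - p'); have := sqr_ge0 (q - q'); rewrite !expr2; lra.
Qed.

Lemma sqmod_conj z : sqmod z^*%C = sqmod z.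
Proof. by case: z => a b; rewrite /sqmod /= sqrrN. Qed.

Lemma conjcD z w : (z + w)^*%C = z^*%C + w^*%C.
Proof. exact: rmorphD. Qed.

Lemma conjcM z w : (z * w)^*%C = z^*%C * w^*%C.
Proof. exact: rmorphM. Qed.

Lemma conjcN z : (- z)^*%C = - z^*%C.
Proof. exact: rmorphN. Qed.

Lemma ReD z w : complex.Re (z + w) = complex.Re z + complex.Re w.
Proof. by case: z w => [a b] [c d]. Qed.

Lemma ReN z : complex.Re (- z) = - complex.Re z.
Proof. by case: z. Qed.

Lemma complexP z w :
  complex.Re z = complex.Re w -> complex.Im z = complex.Im w -> z = w.
Proof. by case: z w => [a b] [c d] /= -> ->. Qed.

Lemma Re_conjc z : complex.Re z^*%C = complex.Re z.
Proof. by case: z. Qed.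

End ComplexNumbers.

(** * Inner product geometry *)

Section InnerProduct.
Variables (R : realType) (V : lmodType R[i]) (ip : V -> V -> R[i]).
Hypothesis ipP : inner_product ip.
Local Notation sq := (sqnorm ip).
Implicit Types (x y z : V) (a : R[i]).

Lemma ipC x y : ip y x = (ip x y)^*%C.
Proof. by case: ipP => _ H _ _; apply: H. Qed.

Lemma ipDl x y z : ip (x + y) z = ip x z + ip y z.
Proof. by case: ipP => H _ _ _; have := H 1 x y z; rewrite scale1r mul1r. Qed.

Lemma ip0l x : ip 0 x = 0.
Proof. by apply: (addrI (ip 0 x)); rewrite -ipDl !addr0. Qed.

Lemma ipZl a x z : ip (a *: x) z = a * ip x z.
Proof. by case: ipP => H _ _ _; have := H a x 0 z; rewrite ip0l !addr0. Qed.

Lemma ipNl x z : ip (- x) z = - ip x z.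
Proof. by rewrite -scaleN1r ipZl mulN1r. Qed.

Lemma ipBl x y z : ip (x - y) z = ip x z - ip y z.
Proof. by rewrite ipDl ipNl. Qed.

Lemma ipDr x y z : ip z (x + y) = ip z x + ip z y.
Proof. by rewrite ipC ipDl conjcD -!ipC. Qed.

Lemma ipZr a x z : ip z (a *: x) = a^*%C * ip z x.
Proof. by rewrite ipC ipZl conjcM -ipC. Qed.

Lemma ip0r x : ip x 0 = 0.
Proof. by rewrite ipC ip0l conjc0. Qed.

Lemma ipNr x z : ip z (- x) = - ip z x.
Proof. by rewrite ipC ipNl conjcN -ipC. Qed.

Lemma ipBr x y z : ip z (x - y) = ip z x - ip z y.
Proof. by rewrite ipDr ipNr. Qed.

Lemma ip_suml (I : Type) (r : seq I) (P : pred I) (F : I -> V) z :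
  ip (\sum_(i <- r | P i) F i) z = \sum_(i <- r | P i) ip (F i) z.
Proof.
elim/big_rec2: _ => [|i y1 y2 _ <-]; first exact: ip0l.
exact: ipDl.
Qed.

Lemma ipE x : ip x x = (sq x)%:C.
Proof.
case: ipP => _ _ /(_ x) + _; rewrite /sqnorm.
by case: (ip x x) => a b; rewrite lecE /= => /andP[/eqP-> _].
Qed.

Lemma sqnorm_ge0 x : 0 <= sq x.
Proof. by case: ipP => _ _ /(_ x) + _; rewrite ipE lecR. Qed.

Lemma sqnorm_eq0 x : sq x = 0 -> x = 0.
Proof. by move=> x0; case: ipP => _ _ _; apply; rewrite ipE x0. Qed.

Lemma sqnorm0 : sq 0 = 0.
Proof. by rewrite /sqnorm ip0l. Qed.

Lemma sqnormD x y : sq (x + y) = sq x + sq y + 2 * complex.Re (ip x y).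
Proof.
rewrite /sqnorm !ipDl !ipDr !ReD [ip y x]ipC Re_conjc; ring.
Qed.

Lemma sqnormZ a x : sq (a *: x) = sqmod a * sq x.
Proof.
rewrite {1}/sqnorm ipZl ipZr mulrA sqmodE ipE -rmorphM //=.
Qed.

Lemma sqnormN x : sq (- x) = sq x.
Proof. by rewrite /sqnorm ipNl ipNr opprK. Qed.

Lemma sqnormB x y : sq (x - y) = sq x + sq y - 2 * complex.Re (ip x y).
Proof. by rewrite sqnormD sqnormN ipNr ReN mulrN. Qed.

Lemma sqnorm_sym x y : sq (x - y) = sq (y - x).
Proof. by rewrite -sqnormN opprB. Qed.

Lemma parallelogram x y : sq (x + y) + sq (x - y) = 2 * sq x + 2 * sq y.
Proof. rewrite sqnormD sqnormB; ring. Qed.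

Lemma sqnormD_le x y : sq (x + y) <= 2 * sq x + 2 * sq y.
Proof. by rewrite -parallelogram lerDl sqnorm_ge0. Qed.

Lemma sqnorm_triangle z x y : sq (x - y) <= 2 * sq (x - z) + 2 * sq (z - y).
Proof. by apply: le_trans (sqnormD_le _ _); rewrite addrA subrK. Qed.

(** The scalar is the projection coefficient [<x, v> / |v|^2]. Multiplying through by [sq v] keeps
    the identity valid for [v = 0]. It yields both Cauchy-Schwarz and the orthogonality of a minimal
    residual. *)
Lemma sqnorm_residual x v : exists a,
  sq (x - a *: v) * sq v = sq x * sq v - sqmod (ip x v).
Proof.
have [v0|v0] := eqVneq (sq v) 0.
  exists 0; rewrite v0 (sqnorm_eq0 v0) ip0r !mulr0 /sqmod /= expr0n /=.
  by rewrite !addr0 subr0.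
exists (ip x v * ((sq v)^-1)%:C).
rewrite sqnormB sqnormZ ipZr.
case: (ip x v) => p q; rewrite /sqmod /=.
by field.
Qed.

Lemma cauchy_schwarz x y : sqmod (ip x y) <= sq x * sq y.
Proof.
have [a ha] := sqnorm_residual x y.
have : 0 <= sq (x - a *: y) * sq y by rewrite mulr_ge0 ?sqnorm_ge0.
by rewrite ha subr_ge0.
Qed.

Lemma normalize x : x <> 0 -> exists a : R[i], sq (a *: x) = 1.
Proof.
move=> x0; exists ((Num.sqrt (sq x))^-1)%:C.
have sx : sq x != 0 by apply/eqP => /sqnorm_eq0.
rewrite sqnormZ /sqmod /= expr0n addr0 exprVn sqr_sqrtr ?sqnorm_ge0 //.
by rewrite mulVf.
Qed.

Lemma sqnorm_small_eq0 x : (forall e : R, 0 < e -> sq x < e) -> x = 0.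
Proof.
move=> H; apply: sqnorm_eq0; apply/eqP/negPn/negP => nx.
have x_gt0 : 0 < sq x by rewrite lt_def nx sqnorm_ge0.
by have := H _ x_gt0; rewrite ltxx.
Qed.

(** The bounds on [sq] above lose a factor 2, which is harmless for limits equal to 0; the genuine
    triangle inequality is what shows in [conj_graph_sqnorm] that two limits have equal norm. *)
Definition nrm x : R := Num.sqrt (sq x).

Lemma nrm_ge0 x : 0 <= nrm x.
Proof. exact: sqrtr_ge0. Qed.

Lemma nrm_sqr x : nrm x ^+ 2 = sq x.
Proof. by rewrite sqr_sqrtr ?sqnorm_ge0. Qed.

Lemma nrmD x y : nrm (x + y) <= nrm x + nrm y.
Proof.
rewrite -(@ler_pXn2r _ 2) ?nnegrE ?addr_ge0 ?nrm_ge0 //.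
rewrite nrm_sqr sqrrD !nrm_sqr sqnormD addrAC lerD2r // lerD2l.
rewrite -[leRHS]mulr_natl ler_pM2l //.
have : complex.Re (ip x y) ^+ 2 <= (nrm x * nrm y) ^+ 2.
  rewrite exprMn !nrm_sqr; apply: le_trans (cauchy_schwarz x y).
  by rewrite lerDl sqr_ge0.
have [r0|r0] := lerP 0 (complex.Re (ip x y)).
  by rewrite ler_pXn2r ?nnegrE ?mulr_ge0 ?nrm_ge0.
by move=> _; apply: le_trans (ltW r0) _; rewrite mulr_ge0 ?nrm_ge0.
Qed.

Lemma nrmN x : nrm (- x) = nrm x.
Proof. by rewrite /nrm sqnormN. Qed.

Lemma nrm_dist x y : `|nrm x - nrm y| <= nrm (x - y).
Proof.
have := nrmD (y - x) x; rewrite subrK -[y - x]opprB nrmN => yx.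
have := nrmD (x - y) y; rewrite subrK ler_norml => xy.
by apply/andP; split; lra.
Qed.

End InnerProduct.

Lemma natSinv_lt (R : realType) (e : R) : 0 < e ->
  exists N : nat, forall n : nat, (N <= n)%N -> n.+1%:R^-1 < e.
Proof.
move=> e0; exists (Num.trunc e^-1) => n Nn.
rewrite invf_plt ?posrE ?ltr0n //; apply: lt_le_trans (truncnS_gt _) _.
by rewrite ler_nat ltnS.
Qed.

Section LinearCombinations.
Variables (R : realType) (V : lmodType R[i]) (I : Type).
Implicit Types (v w : I -> V) (s : seq (R[i] * I)).

(** Lists of pairs allow repeated indices, so [I] needs no decidable equality, addition is
    concatenation, and one list can be evaluated in two families. *)
Definition lincomb v s : V := \sum_(p <- s) p.1 *: v p.2.

Definition scale_coefs (a : R[i]) s := [seq (a * p.1, p.2) | p <- s].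

Definition conj_coefs s := [seq (p.1^*%C, p.2) | p <- s].

Lemma lincomb_cat v s t : lincomb v (s ++ t) = lincomb v s + lincomb v t.
Proof. exact: big_cat. Qed.

Lemma lincomb_scale v a s : lincomb v (scale_coefs a s) = a *: lincomb v s.
Proof.
rewrite /lincomb big_map scaler_sumr; apply: eq_bigr => p _.
by rewrite scalerA.
Qed.

Lemma lincomb1 v (a : R[i]) i : lincomb v [:: (a, i)] = a *: v i.
Proof. exact: big_seq1. Qed.

Lemma conj_coefs_scale a s :
  conj_coefs (scale_coefs a s) = scale_coefs a^*%C (conj_coefs s).
Proof.
rewrite /conj_coefs /scale_coefs -!map_comp; apply: eq_map => p /=.
by rewrite conjcM.
Qed.

Lemma conj_coefs_cat s t : conj_coefs (s ++ t) = conj_coefs s ++ conj_coefs t.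
Proof. exact: map_cat. Qed.

End LinearCombinations.

(** * Total families have dense span *)

Section DenseSpan.
Variables (R : realType) (V : lmodType R[i]) (ip : V -> V -> R[i]).
Hypothesis ipP : inner_product ip.
Hypothesis complV : complete_space ip.
Local Notation sq := (sqnorm ip).

Definition dense_span (I : Type) (v : I -> V) : Prop :=
  forall (x : V) (e : R), 0 < e -> exists s, sq (x - lincomb v s) < e.

Lemma cauchy_of_inv (u : nat -> V) (K : R) : 0 < K ->
  (forall m n, sq (u m - u n) <= K * (m.+1%:R^-1 + n.+1%:R^-1)) ->
  cauchy_seq ip u.
Proof.
move=> K0 H e e0.
have /natSinv_lt[N HN] : 0 < e / (2 * K) by rewrite divr_gt0 ?mulr_gt0.
exists N => m n /HN hm /HN hn; apply: le_lt_trans (H m n) _.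
have := ltrD hm hn; rewrite -(ltr_pM2l K0) => /lt_le_trans; apply.
by rewrite le_eqVlt; apply/orP; left; apply/eqP; field; rewrite gt_eqF.
Qed.

(* The nearest point in the closed span exists because a minimizing sequence
   is Cauchy by the parallelogram law; the residual is orthogonal to [v]. *)
Lemma dense_span_orthogonal (I : Type) (v : I -> V) :
  (forall z, (forall i, ip z (v i) = 0) -> z = 0) -> dense_span v.
Proof.
move=> tot x.
pose D := [set r : R | exists s, r = sq (x - lincomb v s)]%classic.
have infD : has_inf D.
  split; first by exists (sq (x - lincomb v [::])), [::].
  by exists 0 => _ [s ->]; exact: sqnorm_ge0.
pose d := inf D.
have d_le s : d <= sq (x - lincomb v s) by apply: (ge_inf infD.2); exists s.
have /choice[s sP] (n : nat) : exists s, sq (x - lincomb v s) < d + n.+1%:R^-1.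
  have inv_gt0 : 0 < n.+1%:R^-1 :> R by rewrite invr_gt0 ltr0n.
  have [_ [t ->] ht] := inf_adherent inv_gt0 infD.
  by exists t.
pose u n := lincomb v (s n).
have cu : cauchy_seq ip u.
  apply: (@cauchy_of_inv _ 2) => // m n.
  have := parallelogram ipP (x - u m) (x - u n).
  have -> : x - u m - (x - u n) = - (u m - u n).
    by rewrite (opprB x) (opprB (u m)) addrC addrA subrK.
  (* The midpoint of [u m] and [u n] is again a combination, so its squared distance to [x] is at
     least [d]; the parallelogram law leaves at most twice the sum of the two errors for
     [sq (u m - u n)]. *)
  have -> : x - u m + (x - u n) =
      2 *: (x - lincomb v (scale_coefs 2^-1 (s m ++ s n))).
    rewrite lincomb_scale lincomb_cat scalerBr scalerA divff ?pnatr_eq0 //.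
    by rewrite scale1r scaler_nat mulr2n opprD addrACA.
  rewrite sqnormN // sqnormZ //.
  have -> : sqmod (2 : R[i]) = 4 :> R.
    by rewrite /sqmod /= addr0 expr0n /= addr0; ring.
  have := d_le (scale_coefs 2^-1 (s m ++ s n)).
  have := sP m; have := sP n; rewrite -!/(u _).
  by move: (m.+1%:R^-1 : R) (n.+1%:R^-1 : R) => p q; lra.
have [l ul] := complV cu.
suff -> : x = l.
  move=> e /ul[N HN]; exists (s N); rewrite sqnorm_sym //; exact: HN.
apply/eqP; rewrite -subr_eq0; apply/eqP; apply: tot => i.
apply: sqmod_eq0; apply/eqP; rewrite eq_le sqmod_ge0 andbT.
apply/ler_addgt0Pr => e e0; rewrite add0r.
(* Removing the component along [v i] leaves the residual of another combination, so it cannot bring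
   the squared distance below [d]. *)
have resid n : sqmod (ip (x - u n) (v i)) <= n.+1%:R^-1 * sq (v i).
  have [a ha] := sqnorm_residual ipP (x - u n) (v i).
  have : d * sq (v i) <= sq (x - u n - a *: v i) * sq (v i).
    rewrite ler_wpM2r ?sqnorm_ge0 // -addrA -opprD.
    by have := d_le (s n ++ [:: (a, i)]); rewrite lincomb_cat lincomb1.
  have : sq (x - u n) * sq (v i) <= (d + n.+1%:R^-1) * sq (v i).
    by apply: ler_wpM2r; [exact: sqnorm_ge0 | exact/ltW/sP].
  by rewrite ha mulrDl; move: (n.+1%:R^-1 : R) => p; lra.
(* Two error terms, each below [e / K] times [sq (v i)] up to equality, enter with a factor 2; the
   summand 1 keeps [K] positive when [v i = 0]. *)
pose K := 4 * (1 + sq (v i)).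
have K0 : 0 < K by rewrite mulr_gt0 // ltr_pwDl ?sqnorm_ge0.
have [N1 H1] := natSinv_lt (divr_gt0 e0 K0).
have [N2 H2] := ul _ (divr_gt0 e0 K0).
pose n := maxn N1 N2.
have {}H1 := H1 n (leq_maxl _ _); have {}H2 := H2 n (leq_maxr _ _).
have -> : x - l = (x - u n) + (u n - l) by rewrite addrA subrK.
rewrite ipDl //; apply: le_trans (sqmodD_le _ _) _.
have h1 := resid n; have h2 := cauchy_schwarz ipP (u n - l) (v i).
have v0 := sqnorm_ge0 ipP (v i).
have -> : e = (e / K) * K by field; rewrite gt_eqF.
have : 0 < e / K by rewrite divr_gt0.
have := ler_wpM2r v0 (ltW H1); have := ler_wpM2r v0 (ltW H2).
move: h1 h2; move: (n.+1%:R^-1 : R) (e / K) => p r.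
move: (sqmod _) (sqmod _) (sq (u n - l)) => a b t; rewrite /K; lra.
Qed.

End DenseSpan.

(** * Conjugate-linear isometries from conjugate Gram matrices *)

Section ConjugateExtension.
Variables (R : realType) (V : lmodType R[i]) (ip : V -> V -> R[i]).
Hypothesis ipP : inner_product ip.
Hypothesis complV : complete_space ip.
Local Notation sq := (sqnorm ip).
Variables (I : Type) (v w : I -> V).
Hypothesis gram : forall i j, ip (w i) (w j) = (ip (v i) (v j))^*%C.
Hypothesis dense_v : dense_span ip v.

Lemma ip_lincomb (u u' : I -> V) s t : ip (lincomb u s) (lincomb u' t) =
  \sum_(p <- s) \sum_(q <- t) p.1 * q.1^*%C * ip (u p.2) (u' q.2).
Proof.
rewrite ip_suml //; apply: eq_bigr => p _.
rewrite ipC // ip_suml // raddf_sum /=; apply: eq_bigr => q _.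
by rewrite -(ipC ipP) (ipZl ipP) (ipZr ipP) mulrA.
Qed.

Lemma sqnorm_lincomb_conj s : sq (lincomb w (conj_coefs s)) = sq (lincomb v s).
Proof.
rewrite /sqnorm -(Re_conjc (ip (lincomb v s) _)); congr complex.Re.
rewrite !ip_lincomb big_map raddf_sum; apply: eq_bigr => p _.
rewrite big_map raddf_sum; apply: eq_bigr => q _ /=.
by rewrite (conjcM (p.1 * _)) (conjcM p.1) gram.
Qed.

(** The closure of the graph of [sum a_i v_i |-> sum conj(a_i) w_i]. It is a relation because the
    [v i] may be linearly dependent; the same list [s] must serve on both sides. *)
Definition conj_graph (x y : V) : Prop := forall e : R, 0 < e ->
  exists s, sq (x - lincomb v s) < e /\ sq (y - lincomb w (conj_coefs s)) < e.

Lemma conj_graph_total x : exists y, conj_graph x y.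
Proof.
have /choice[s sP] (n : nat) : exists s, sq (x - lincomb v s) < n.+1%:R^-1.
  by apply: dense_v; rewrite invr_gt0 ltr0n.
pose u n := lincomb w (conj_coefs (s n)).
have cu : cauchy_seq ip u.
  apply: (@cauchy_of_inv _ _ _ _ 2) => // m n.
  have -> : u m - u n =
      lincomb w (conj_coefs (s m ++ scale_coefs (- 1) (s n))).
    rewrite conj_coefs_cat conj_coefs_scale lincomb_cat lincomb_scale.
    by rewrite conjcN conjc1 scaleN1r.
  rewrite sqnorm_lincomb_conj lincomb_cat lincomb_scale scaleN1r.
  apply: le_trans (sqnorm_triangle ipP x _ _) _.
  rewrite sqnorm_sym //; have := sP m; have := sP n.
  by move: (m.+1%:R^-1 : R) (n.+1%:R^-1 : R) => p q; lra.
have [l ul] := complV cu; exists l => e e0.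
have [N1 H1] := natSinv_lt e0; have [N2 H2] := ul _ e0.
exists (s (maxn N1 N2)); split.
  by apply: lt_trans (sP _) _; apply: H1; exact: leq_maxl.
by rewrite sqnorm_sym //; apply: H2; exact: leq_maxr.
Qed.

Lemma conj_graph_linear a x x' y y' :
  conj_graph x y -> conj_graph x' y' ->
  conj_graph (a *: x + x') (a^*%C *: y + y').
Proof.
move=> H H' e e0.
have K0 : 0 < 2 * (sqmod a + 1).
  by rewrite mulr_gt0 // ltr_wpDl ?sqmod_ge0.
have d0 : 0 < e / (2 * (sqmod a + 1)) by rewrite divr_gt0.
have [s [h1 h2]] := H _ d0; have [s' [h1' h2']] := H' _ d0.
have bound (z z' t t' : V) (b : R[i]) : sqmod b = sqmod a ->
    sq (z - t) < e / (2 * (sqmod a + 1)) ->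
    sq (z' - t') < e / (2 * (sqmod a + 1)) ->
    sq (b *: z + z' - (b *: t + t')) < e.
  move=> ba zt zt'; rewrite opprD addrACA -scalerBr.
  apply: le_lt_trans (sqnormD_le ipP _ _) _; rewrite sqnormZ // ba.
  have -> : e = 2 * (sqmod a * (e / (2 * (sqmod a + 1)))) +
                2 * (e / (2 * (sqmod a + 1))).
    by field; rewrite gt_eqF // ltr_wpDl ?sqmod_ge0.
  by apply: ler_ltD; rewrite ?ltr_pM2l // ler_pM2l // ler_wpM2l ?sqmod_ge0 // ltW.
exists (scale_coefs a s ++ s'); split.
  by rewrite lincomb_cat lincomb_scale; exact: bound.
rewrite conj_coefs_cat conj_coefs_scale lincomb_cat lincomb_scale.
by apply: bound => //; rewrite sqmod_conj.
Qed.

Lemma conj_graph_sqnorm x y : conj_graph x y -> sq x = sq y.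
Proof.
move=> H; rewrite -!nrm_sqr //; congr (_ ^+ 2).
apply/eqP; rewrite -subr_eq0 -normr_le0; apply/ler_addgt0Pr => e e0.
rewrite add0r.
have [s [h1 h2]] := H ((e / 2) ^+ 2) (exprn_gt0 2 (divr_gt0 e0 (ltr0Sn _ 1))).
have half z t : sq (z - t) < (e / 2) ^+ 2 -> `|nrm ip z - nrm ip t| <= e / 2.
  move=> /ltW zt; apply: le_trans (nrm_dist ipP z t) _.
  by rewrite -(@ler_pXn2r _ 2) ?nnegrE ?nrm_ge0 ?divr_ge0 ?(ltW e0) ?nrm_sqr.
have := half _ _ h1; have := half _ _ h2.
have -> : nrm ip (lincomb w (conj_coefs s)) = nrm ip (lincomb v s).
  by rewrite /nrm sqnorm_lincomb_conj.
rewrite !ler_norml.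
by move=> /andP[? ?] /andP[? ?]; apply/andP; split; lra.
Qed.

(** The difference of the two pairs is in the graph with first component 0, so its second component
    has norm 0. *)
Lemma conj_graph_unique x y y' : conj_graph x y -> conj_graph x y' -> y = y'.
Proof.
move=> H H'; have := conj_graph_linear (- 1) H H'.
rewrite scaleN1r addNr conjcN conjc1 scaleN1r => /conj_graph_sqnorm.
rewrite sqnorm0 // addrC => /esym/(sqnorm_eq0 ipP)/eqP.
by rewrite subr_eq0 => /eqP.
Qed.

Lemma conj_linear_extension : exists C : V -> V,
  [/\ forall (a : R[i]) x y, C (a *: x + y) = a^*%C *: C x + C y,
      forall x, sq (C x) = sq x & forall i, C (v i) = w i].
Proof.
have [C CP] := choice conj_graph_total.
exists C; split.
- move=> a x y.
  exact: conj_graph_unique (CP _) (conj_graph_linear a (CP x) (CP y)).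
- by move=> x; rewrite -(conj_graph_sqnorm (CP x)).
- move=> i; apply: conj_graph_unique (CP _) _ => e e0; exists [:: (1, i)].
  rewrite -[conj_coefs _]/[:: (1^*%C, i)] conjc1 !lincomb1 !scale1r !subrr.
  by rewrite sqnorm0.
Qed.

Lemma isometry_eq_on_dense (F G : V -> V) :
  (forall x y, sq (F x - F y) = sq (x - y)) ->
  (forall x y, sq (G x - G y) = sq (x - y)) ->
  (forall s, F (lincomb v s) = G (lincomb v s)) -> F =1 G.
Proof.
move=> HF HG FG x; apply/eqP; rewrite -subr_eq0; apply/eqP.
apply: (sqnorm_small_eq0 ipP) => e e0.
have [s hs] := dense_v x (divr_gt0 e0 (ltr0Sn _ 3)).
apply: le_lt_trans (sqnorm_triangle ipP (F (lincomb v s)) _ _) _.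
by rewrite {2}FG HF HG [in X in _ + 2 * X]sqnorm_sym //; lra.
Qed.

End ConjugateExtension.

(** * Linear and antilinear maps treated together *)

Section Semilinear.
Variables (R : realType) (V : lmodType R[i]) (ip : V -> V -> R[i]).
Hypothesis ipP : inner_product ip.
Local Notation sq := (sqnorm ip).
Variable f : R[i] -> R[i].
Hypotheses (f1 : f 1 = 1) (fN1 : f (- 1) = - 1).

(** With [f] the identity or the conjugation of scalars, a single density argument proves both
    [C C = 1], between linear maps, and [U C = C U'], between antilinear ones. *)
Definition semilinear (F : V -> V) : Prop :=
  forall a x y, F (a *: x + y) = f a *: F x + F y.

Lemma semilinearD F x y : semilinear F -> F (x + y) = F x + F y.
Proof. by move=> linF; rewrite -{1}(scale1r x) linF f1 scale1r. Qed.

Lemma semilinear0 F : semilinear F -> F 0 = 0.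
Proof. by move=> linF; apply: (addrI (F 0)); rewrite -semilinearD // !addr0. Qed.

Lemma semilinearB F x y : semilinear F -> F (x - y) = F x - F y.
Proof. by move=> linF; rewrite addrC -scaleN1r linF fN1 scaleN1r addrC. Qed.

Lemma semilinearZ F a x : semilinear F -> F (a *: x) = f a *: F x.
Proof. by move=> linF; rewrite -[a *: x]addr0 linF semilinear0 // addr0. Qed.

Lemma semilinear_isometry_eq (I : Type) (v : I -> V) (F G : V -> V) :
  dense_span ip v -> semilinear F -> semilinear G ->
  (forall x, sq (F x) = sq x) -> (forall x, sq (G x) = sq x) ->
  (forall i, F (v i) = G (v i)) -> F =1 G.
Proof.
move=> dense_v linF linG isoF isoG FG.
apply: (isometry_eq_on_dense ipP dense_v).
- by move=> x y; rewrite -semilinearB.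
- by move=> x y; rewrite -semilinearB.
- elim=> [|[a i] s IHs]; rewrite /lincomb ?big_nil ?semilinear0 // big_cons.
  by rewrite linF linG FG IHs.
Qed.

End Semilinear.

(** * Conjugations and the kernels of complex symmetric operators *)

Section Conjugation.
Variables (R : realType) (V : lmodType R[i]) (ip : V -> V -> R[i]).
Hypothesis ipP : inner_product ip.
Local Notation sq := (sqnorm ip).

Lemma conjcN1 : (- 1 : R[i])^*%C = - 1.
Proof. by rewrite conjcN conjc1. Qed.

(** Polarization: [sq (x + y)] determines the real part, and replacing [x] by ['i *: x] gives the
    imaginary part, with a change of sign because [C] is antilinear. *)
Lemma conj_isometry_ip (C : V -> V) :
  semilinear (@conjc R) C -> (forall x, sq (C x) = sq x) ->
  forall x y, ip (C x) (C y) = (ip x y)^*%C.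
Proof.
move=> linC isoC.
have re x y : complex.Re (ip (C x) (C y)) = complex.Re (ip x y).
  have := isoC (x + y).
  rewrite (semilinearD _ _ _ linC) ?conjc1 // !sqnormD // !isoC; lra.
move=> x y; apply: complexP; first by rewrite re Re_conjc.
have := re ('i *: x) y.
rewrite (semilinearZ _ _ _ linC) ?conjc1 // !ipZl //.
by case: (ip x y) (ip (C x) (C y)) => [a b] [c d] /=; lra.
Qed.

Lemma has_orthonormal_conj (C : V -> V) (K K' : V -> Prop) n :
  conjugation ip C -> (forall x, K x -> K' (C x)) ->
  has_orthonormal ip K n -> has_orthonormal ip K' n.
Proof.
move=> [linC isoC _] KC [e [Ke oe]]; exists (C \o e); split=> [i|i j] /=.
  exact/KC/Ke.
by rewrite conj_isometry_ip // oe conjc_nat.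
Qed.

Lemma has_orthonormal_leq (K : V -> Prop) m n : (m <= n)%N ->
  has_orthonormal ip K n -> has_orthonormal ip K m.
Proof.
move=> mn [e [Ke oe]]; exists (e \o widen_ord mn); split=> [i|i j] /=.
  exact: Ke.
by rewrite oe; congr (_%:R); congr nat_of_bool; apply/eqP/eqP => [[/val_inj]|->].
Qed.

Lemma dim_is_unique (K K' : V -> Prop) d d' :
  (forall n, has_orthonormal ip K n <-> has_orthonormal ip K' n) ->
  dim_is ip K d -> dim_is ip K' d' -> d = d'.
Proof.
move=> KK'; case: d d' => [n|] [n'|] //=.
- move=> [h1 h2] [h1' h2']; have [lt_n|lt_n|-> //] := ltngtP n n'.
    by case: (h2 ((KK' _).2 (has_orthonormal_leq lt_n h1'))).
  by case: (h2' ((KK' _).1 (has_orthonormal_leq lt_n h1))).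
- by move=> [_ h] h'; case: h; apply: (KK' _).2.
- by move=> h [_ h']; case: h'; apply: (KK' _).1.
Qed.

Lemma complex_symmetric_dim (T Tadj : V -> V) d d' :
  complex_symmetric ip T Tadj ->
  dim_is ip (kernel T) d -> dim_is ip (kernel Tadj) d' -> d = d'.
Proof.
move=> [C [Cc TC]]; apply: dim_is_unique => n.
have [linC _ CK] := Cc.
have C0 : C 0 = 0 := semilinear0 (conjc1 R) linC.
split; apply: has_orthonormal_conj Cc _ => x; rewrite /kernel.
  by rewrite TC => /(congr1 C); rewrite CK C0.
by rewrite TC CK => ->.
Qed.

End Conjugation.

(** * Unitary operators are complex symmetric *)

Section Unitary.
Variables (R : realType) (V : lmodType R[i]) (ip : V -> V -> R[i]).
Hypothesis ipP : inner_product ip.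
Hypothesis complV : complete_space ip.
Local Notation sq := (sqnorm ip).
Variables U U' : V -> V.
Hypotheses (linU : linear_op U) (linU' : linear_op U').
Hypotheses (UK : cancel U U') (U'K : cancel U' U).
Hypothesis adjU : is_adjoint ip U U'.

Definition zpow (k : int) (x : V) : V :=
  match k with Posz n => iter n U x | Negz n => iter n.+1 U' x end.

Lemma zpowS k x : zpow (k + 1) x = U (zpow k x).
Proof.
case: k => [n|[|n]]; first by rewrite -PoszD addn1.
  by rewrite [LHS]/= U'K.
have -> : Negz n.+1 + 1 = Negz n by lia.
by rewrite [RHS]/= U'K.
Qed.

Lemma zpow_pred k x : zpow (k - 1) x = U' (zpow k x).
Proof. by rewrite -{2}(subrK 1 k) zpowS UK. Qed.

Lemma zpowD j k x : zpow (j + k) x = zpow j (zpow k x).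
Proof.
elim/int_ind: j => [|n IHn|n IHn]; first by rewrite add0r.
  by rewrite -addn1 PoszD addrAC !zpowS IHn.
by rewrite -addn1 PoszD opprD addrAC !zpow_pred IHn.
Qed.

Lemma adjU' x y : ip (U' x) y = ip x (U y).
Proof. by rewrite (ipC ipP) -adjU -(ipC ipP). Qed.

Lemma zpow_adj k x y : ip (zpow k x) y = ip x (zpow (- k) y).
Proof.
elim/int_ind: k x y => [|n IHn|n IHn] x y //.
  by rewrite -addn1 PoszD zpowS adjU IHn opprD -[U' y]/(zpow (- 1) y) -zpowD.
rewrite -addn1 PoszD opprD zpow_pred adjU' IHn opprD !opprK.
by rewrite -[U y]/(zpow 1 y) -zpowD.
Qed.

Lemma ip_zpow j k x y : ip (zpow j x) (zpow k y) = ip (zpow (j - k) x) y.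
Proof. by rewrite addrC zpowD (zpow_adj (- k)) opprK. Qed.

(** By [ip_zpow], one power of [U] on one side accounts for all pairs of points of the two
    orbits. *)
Definition orbit_orthogonal (A : set V) : Prop :=
  forall a b k, A a -> A b -> a <> b -> ip (zpow k a) b = 0.

(** A nonzero vector orthogonal to all orbits of the family has its whole orbit orthogonal to them,
    by [zpow_adj], so it could be adjoined to a maximal family. *)
Lemma maximal_orbit_orthogonal e : exists A : set V,
  [/\ A e, orbit_orthogonal A &
    forall z, (forall k a, A a -> ip z (zpow k a) = 0) -> z = 0].
Proof.
(* Requiring [e] to belong to [A] would fail for the union of the empty chain; instead [e] is
   adjoined inside the predicate. *)
pose P : set (set V) := fun A => orbit_orthogonal (A `|` [set e])%classic.
have [|A [PA maxA]] := @Zorn_bigcup _ P.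
  move=> F FP totF a b k Fa Fb ab.
  have chain x y : (\bigcup_(X in F) X)%classic x ->
      ((\bigcup_(X in F) X) `|` [set e])%classic y ->
      exists2 X, F X & X x /\ (X `|` [set e])%classic y.
    move=> [X FX Xx] [[Y FY Yy]|ye]; last by exists X => //; split=> //; right.
    have [XY|YX] := totF _ _ FX FY.
      by exists Y => //; split; [exact: XY | left].
    by exists X => //; split=> //; left; apply: YX.
  case: Fa => [Fa|ae].
    by have [X FX [Xa Xb]] := chain _ _ Fa Fb; apply: (FP _ FX) => //; left.
  case: Fb => [Fb|be]; last by rewrite ae be in ab.
  have [X FX [Xb Xa]] := chain b a Fb (or_intror ae).
  by apply: (FP _ FX) => //; left.
exists (A `|` [set e])%classic; split=> // [|z zA]; first by right.
have [//|/eqP z0] := eqVneq z 0.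
have zz : ~ (A `|` [set e])%classic z.
  by move=> /(zA 0) /= h; apply: z0; case: ipP => _ _ _; apply.
case: (maxA (A `|` [set z])%classic).
  split; first by move=> x; left.
  by move=> /(_ z) h; apply: zz; left; apply: h; right.
have split_or x : ((A `|` [set z]) `|` [set e])%classic x ->
    (A `|` [set e])%classic x \/ x = z.
  by case=> [[]|]; [left; left | right | left; right].
move=> a b k /split_or[Aa|->] /split_or[Ab|->] ab //.
- exact: PA.
- by rewrite (ipC ipP) zA // conjc0.
- by rewrite zpow_adj zA.
Qed.

Lemma unitary_isometry x : sq (U x) = sq x.
Proof. by rewrite /sqnorm adjU UK. Qed.

Lemma unitary_isometry' x : sq (U' x) = sq x.
Proof. by rewrite /sqnorm adjU' U'K. Qed.

(* [C] reverses each orbit: [C (U^k a) = U^(1-k) a] for [a] in a family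
   containing [e] whose orbits are orthogonal and span a dense subspace. The
   Gram matrix of an orbit is Toeplitz, hence the reversal is antiunitary. *)
Lemma unitary_conjugation e : exists C, [/\ conjugation ip C,
  forall x, U x = C (U' (C x)) & C e = U e].
Proof.
have [A [Ae orthA totA]] := maximal_orbit_orthogonal e.
pose I := (int * {a | A a})%type.
pose v (i : I) := zpow i.1 (sval i.2).
pose w (i : I) := zpow (1 - i.1) (sval i.2).
have gram i j : ip (w i) (w j) = (ip (v i) (v j))^*%C.
  case: i j => [k [a Aa]] [l [b Ab]]; rewrite /v /w /= !ip_zpow.
  have -> : 1 - k - (1 - l) = - (k - l) by ring.
  have [<-|ab] := pselect (a = b).
    by rewrite -(ipC ipP) zpow_adj opprK.
  by rewrite !orthA // conjc0.
have dense_v : dense_span ip v.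
  apply: dense_span_orthogonal => // z zv; apply: totA => k a Aa.
  exact: (zv (k, exist _ a Aa)).
have [C [linC isoC Cv]] := conj_linear_extension ipP complV gram dense_v.
have CK : C \o C =1 id.
  apply: (@semilinear_isometry_eq _ _ _ ipP id) dense_v _ _ _ _ _ => //.
  - by move=> a x y /=; rewrite !linC conjcK.
  - by move=> x /=; rewrite !isoC.
  - move=> i /=; rewrite Cv -[w i]/(v (1 - i.1, i.2)) Cv /w /v /=.
    by rewrite opprB addrC subrK.
(* On [U^k a] both sides are [U^(2-k) a]. *)
have UC : U \o C =1 C \o U'.
  apply: (@semilinear_isometry_eq _ _ _ ipP (@conjc R)) dense_v _ _ _ _ _ => /=.
  - exact: conjc1.
  - exact: conjcN1.
  - by move=> a x y /=; rewrite linC linU.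
  - by move=> a x y /=; rewrite linU' linC.
  - by move=> x /=; rewrite unitary_isometry isoC.
  - by move=> x /=; rewrite isoC unitary_isometry'.
  - move=> i /=; rewrite Cv /w -zpowS {1}/v -zpow_pred -/(v (i.1 - 1, i.2)) Cv.
    by rewrite /w /=; congr zpow; ring.
exists C; split.
- by split.
- by move=> x; rewrite -[LHS](congr1 U (CK x)); exact: UC.
- by have := Cv (0, exist _ e Ae).
Qed.

End Unitary.

(** * Partial isometries with kernels of dimension at most 1 *)

Section PartialIsometry.
Variables (R : realType) (V : lmodType R[i]) (ip : V -> V -> R[i]).
Hypothesis ipP : inner_product ip.
Local Notation sq := (sqnorm ip).

Lemma linear_op0 (F : V -> V) : linear_op F -> F 0 = 0.
Proof. exact: (@semilinear0 _ _ id). Qed.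

Lemma linear_opD (F : V -> V) x y : linear_op F -> F (x + y) = F x + F y.
Proof. exact: (@semilinearD _ _ id). Qed.

Lemma linear_opB (F : V -> V) x y : linear_op F -> F (x - y) = F x - F y.
Proof. exact: (@semilinearB _ _ id). Qed.

Lemma linear_opZ (F : V -> V) a x : linear_op F -> F (a *: x) = a *: F x.
Proof. exact: (@semilinearZ _ _ id). Qed.

Lemma ip_nondegenerate x y : (forall z, ip z x = ip z y) -> x = y.
Proof.
move=> xy; apply/eqP; rewrite -subr_eq0; apply/eqP; apply: (sqnorm_eq0 ipP).
by rewrite /sqnorm (ipBr ipP) xy subrr.
Qed.

(** Otherwise a normalized residual would enlarge the orthonormal family. Taking [e = 0] in
    dimension 0 gives one formula for both cases, and [sq e] depends on [d] alone, so the generators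
    of two subspaces of equal dimension have equal norm. *)
Lemma subspace_dim_le1 (K : V -> Prop) d :
  K 0 -> (forall a x y, K x -> K y -> K (a *: x + y)) ->
  dim_is ip K d -> hdim_le1 d ->
  exists e, [/\ K e, sq e = (if d is Fin 1 then 1 else 0) &
    forall x, K x -> x = ip x e *: e].
Proof.
move=> K0 Klin; have KZ a x : K x -> K (a *: x).
  by move=> Kx; rewrite -[_ *: _]addr0; apply: Klin.
case: d => [[|[|n]]|] //= [].
  move=> _ no1 _; exists 0; split=> // [|x Kx]; first exact: sqnorm0.
  rewrite scaler0; apply: contrapT => /(normalize ipP)[a ax]; apply: no1.
  exists (fun=> a *: x); split=> [_|i j]; first exact: KZ.
  by rewrite !ord1 (ipE ipP) ax.
move=> [u [Ku uu]] no2 _.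
have ue : ip (u ord0) (u ord0) = 1 by rewrite uu.
exists (u ord0); split=> [||x Kx]; first exact: Ku.
  by rewrite /sqnorm ue.
apply/eqP; rewrite -subr_eq0; apply/negPn/negP => /eqP.
set y := x - _ => /(normalize ipP)[a ay]; apply: no2.
have yu : ip y (u ord0) = 0 by rewrite (ipBl ipP) (ipZl ipP) ue mulr1 subrr.
have uy : ip (u ord0) y = 0 by rewrite (ipC ipP) yu conjc0.
exists (fun i : 'I_2 => if i == 0 then u ord0 else a *: y); split=> [i|i j].
  case: ifP => _; first exact: Ku.
  by apply: KZ; rewrite /y addrC -scaleNr; apply: Klin.
case: i j => [[|[|//]] ?] [[|[|//]] ?] /=; rewrite ?ue //.
- by rewrite (ipZr ipP) uy mulr0.
- by rewrite (ipZl ipP) yu mulr0.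
- by rewrite (ipE ipP) ay.
Qed.

Variables T Tadj : V -> V.
Hypotheses (linT : linear_op T) (adjT : is_adjoint ip T Tadj).
Hypothesis pisoT : partial_isometry ip T Tadj.

Lemma adjT' x y : ip (Tadj x) y = ip x (T y).
Proof. by rewrite (ipC ipP) -adjT -(ipC ipP). Qed.

Lemma adjoint_linear : linear_op Tadj.
Proof.
move=> a x y; apply: ip_nondegenerate => z.
by rewrite -adjT !(ipDr ipP) !(ipZr ipP) -!adjT.
Qed.

(** With [z = x - Tadj (T x)], idempotence gives [Tadj (T z) = 0], hence
    [|T z|^2 = <z, Tadj (T z)> = 0]. *)
Lemma partial_isometry_TTT x : T (Tadj (T x)) = T x.
Proof.
have [idem _] := pisoT.
apply/esym/eqP; rewrite -subr_eq0; apply/eqP/(sqnorm_eq0 ipP).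
rewrite -linear_opB // /sqnorm adjT (linear_opB _ _ linT).
by rewrite (linear_opB _ _ adjoint_linear) idem subrr (ip0r ipP).
Qed.

Lemma partial_isometry_adjTTT x : Tadj (T (Tadj x)) = Tadj x.
Proof.
apply: ip_nondegenerate => z.
by rewrite -!adjT -adjT' -adjT partial_isometry_TTT.
Qed.

(* With unit vectors [e], [f] spanning the two kernels (or [e = f = 0]),
   [T + <., e> f] is unitary. *)
Lemma partial_isometry_complex_symmetric d : complete_space ip ->
  dim_is ip (kernel T) d -> dim_is ip (kernel Tadj) d ->
  hdim_le1 d -> complex_symmetric ip T Tadj.
Proof.
move=> complV dT dTadj d1; have linT' := adjoint_linear.
have kerK (F : V -> V) : linear_op F -> forall a x y, kernel F x -> kernel F y ->
    kernel F (a *: x + y).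
  by move=> linF a x y; rewrite /kernel linF => -> ->; rewrite scaler0 addr0.
have [e [Te ee kerT]] :=
  subspace_dim_le1 (linear_op0 linT) (kerK _ linT) dT d1.
have [f [Tf ff kerT']] :=
  subspace_dim_le1 (linear_op0 linT') (kerK _ linT') dTadj d1.
have ffe : ip f f *: e = e.
  by rewrite (ipE ipP) ff -ee -(ipE ipP) -kerT.
have eef : ip e e *: f = f.
  by rewrite (ipE ipP) ee -ff -(ipE ipP) -kerT'.
rewrite /kernel in Te Tf.
pose U x := T x + ip x e *: f.
pose U' y := Tadj y + ip y f *: e.
have linU : linear_op U.
  move=> a x y; rewrite /U linT (ipDl ipP) (ipZl ipP) scalerDl scalerDr scalerA.
  by rewrite addrACA.
have linU' : linear_op U'.
  move=> a x y; rewrite /U' linT' (ipDl ipP) (ipZl ipP) scalerDl scalerDr scalerA.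
  by rewrite addrACA.
have UK : cancel U U'.
  move=> x; rewrite /U /U' (linear_opD _ _ linT') (linear_opZ _ _ linT') Tf.
  rewrite (ipDl ipP) adjT Tf (ip0r ipP) (ipZl ipP) add0r -scalerA ffe.
  (* [x - Tadj (T x)] lies in [ker T], so it equals [<x, e> e]: the rank-one term restores exactly
     what [Tadj (T x)] loses. *)
  have := kerT (x - Tadj (T x)); rewrite /kernel (linear_opB _ _ linT).
  rewrite partial_isometry_TTT subrr (ipBl ipP) adjT' Te (ip0r ipP) subr0.
  by move=> <- //; rewrite scaler0 addr0 addrC subrK.
have U'K : cancel U' U.
  move=> x; rewrite /U /U' (linear_opD _ _ linT) (linear_opZ _ _ linT) Te.
  rewrite (ipDl ipP) adjT' Te (ip0r ipP) (ipZl ipP) add0r -scalerA eef.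
  have := kerT' (x - T (Tadj x)); rewrite /kernel (linear_opB _ _ linT').
  rewrite partial_isometry_adjTTT subrr (ipBl ipP) adjT Tf (ip0r ipP) subr0.
  by move=> <- //; rewrite scaler0 addr0 addrC subrK.
have adjU : is_adjoint ip U U'.
  move=> x y; rewrite /U /U' (ipDl ipP) (ipDr ipP) (ipZl ipP) (ipZr ipP) adjT.
  by rewrite -(ipC ipP) [_ * ip f y]mulrC.
have [C [Cc UC Ce]] := unitary_conjugation ipP complV linU linU' UK U'K adjU e.
have [linC isoC CK] := Cc.
have Cef : C e = f by rewrite Ce /U Te add0r.
exists C; split=> // x.
(* As [C e = f] and [C] conjugates inner products, [C] turns [<C x, f> e] into [<x, e> f], the
   correction between [U] and [T]. *)
have -> : Tadj (C x) = U' (C x) - ip (C x) f *: e by rewrite /U' addrK.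
rewrite (semilinearB (conjcN1 R) _ _ linC) -UC.
rewrite (semilinearZ (conjc1 R) _ _ linC) Cef -Cef.
by rewrite (conj_isometry_ip ipP linC isoC) conjcK Cef /U addrK.
Qed.

End PartialIsometry.

(** * The Hilbert space of square-summable sequences supported in [P] *)

Section SquareSummable.
Local Open Scope classical_set_scope.
Local Open Scope ring_scope.
Variables (R : realType) (P : pred nat).

(** The support condition lets one construction provide every dimension: initial segments for the
    finite ones, all of [nat] for the infinite one. *)
Definition square_summable (g : nat -> R[i]) : Prop :=
  (forall i, ~~ P i -> g i = 0) /\
  exists M : R, forall n, \sum_(i < n) sqmod (g i) <= M.

Definition l2_pred : pred (nat -> R[i]) := [pred g | `[< square_summable g >]].

Lemma sqmodN (z : R[i]) : sqmod (- z) = sqmod z.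
Proof. by case: z => a b; rewrite /sqmod /= !sqrrN. Qed.

Lemma sqmodM (z w : R[i]) : sqmod (z * w) = sqmod z * sqmod w.
Proof. by case: z w => [p q] [p' q']; rewrite /sqmod /=; ring. Qed.

Lemma l2_submod_closed : submod_closed l2_pred.
Proof.
split=> [|a x y /asboolP[x0 [M HM]] /asboolP[y0 [N HN]]]; apply/asboolP.
  split=> //; exists 0 => n; rewrite big1 // => i _.
  by rewrite /sqmod /= expr0n addr0.
split=> [i Pi|].
  by rewrite -[LHS]/(a * x i + y i) x0 // y0 // mulr0 addr0.
exists (2 * (sqmod a * M) + 2 * N) => n.
apply: (@le_trans _ _ (\sum_(i < n) (2 * (sqmod a * sqmod (x i)) +
                                      2 * sqmod (y i)))).
  by apply: ler_sum => i _; rewrite -sqmodM; exact: sqmodD_le.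
rewrite big_split -!mulr_sumr; apply: lerD; rewrite ler_pM2l //.
by apply: ler_wpM2l (HM n); exact: sqmod_ge0.
Qed.

HB.instance Definition _ := GRing.isSubmodClosed.Build R[i] (nat -> R[i]) l2_pred
  l2_submod_closed.

Record l2 := L2 { l2val :> nat -> R[i]; l2valP : l2val \in l2_pred }.

HB.instance Definition _ := [isSub for l2val].
HB.instance Definition _ := [Choice of l2 by <:].
HB.instance Definition _ := [SubChoice_isSubLmodule of l2 by <:].

Lemma l2D (x y : l2) i : (x + y) i = x i + y i.
Proof. by []. Qed.

Lemma l2Z a (x : l2) i : (a *: x) i = a * x i.
Proof. by []. Qed.

Lemma l2B (x y : l2) i : (x - y) i = x i - y i.
Proof. by []. Qed.

Lemma l2_supp (x : l2) i : ~~ P i -> x i = 0.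
Proof. by case: x => x /= /asboolP[+ _]; apply. Qed.

Lemma l2_eq (x y : l2) : (forall i, x i = y i) -> x = y.
Proof. by move=> xy; apply: val_inj; apply/funext. Qed.

Definition csum (z : nat -> R[i]) : R[i] :=
  limn (series (fun i => complex.Re (z i))) +i*
  limn (series (fun i => complex.Im (z i))).

Definition csummable (z : nat -> R[i]) : Prop :=
  cvgn (series (fun i => complex.Re (z i))) /\
  cvgn (series (fun i => complex.Im (z i))).

Lemma csummable_le (z : nat -> R[i]) (v : nat -> R) :
  (forall i, `|complex.Re (z i)| <= v i) ->
  (forall i, `|complex.Im (z i)| <= v i) ->
  cvgn (series v) -> csummable z.
Proof.
move=> zr zi cv; have v0 i : 0 <= v i by apply: le_trans (zr i).
by split; apply: normed_cvg; apply: series_le_cvg cv => // i; apply: normr_ge0.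
Qed.

Lemma csumD (z w : nat -> R[i]) : csummable z -> csummable w ->
  csum (fun i => z i + w i) = csum z + csum w.
Proof.
move=> [zr zi] [wr wi]; rewrite /csum -[RHS]/(_ +i* _) -!lim_seriesD //.
by congr (limn (series _) +i* limn (series _)); apply/funext => i;
  rewrite fctE; case: (z i) (w i) => [a b] [c d].
Qed.

Lemma csumZ a (z : nat -> R[i]) : csummable z ->
  csum (fun i => a * z i) = a * csum z.
Proof.
case: a => p q [zr zi]; rewrite /csum -[RHS]/(_ +i* _).
have zr' (k : R) := @is_cvg_seriesZ R _ k zr.
have zi' (k : R) := @is_cvg_seriesZ R _ k zi.
have Er (k : R) : k * limn (series (fun i => complex.Re (z i))) =
    limn (series (k *: (fun i => complex.Re (z i)))) by rewrite lim_seriesZ.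
have Ei (k : R) : k * limn (series (fun i => complex.Im (z i))) =
    limn (series (k *: (fun i => complex.Im (z i)))) by rewrite lim_seriesZ.
rewrite !Er !Ei -lim_seriesB // -lim_seriesD //.
by congr (limn (series _) +i* limn (series _)); apply/funext => i /=;
  rewrite ?fctE; case: (z i) => [a b].
Qed.

Lemma csum_conj (z : nat -> R[i]) : csummable z ->
  csum (fun i => (z i)^*%C) = (csum z)^*%C.
Proof.
move=> [zr zi]; rewrite /csum -[RHS]/(_ -i* _) -lim_seriesN //.
by congr (limn (series _) +i* limn (series _)); apply/funext => i /=;
  rewrite ?fctE; case: (z i) => [a b].
Qed.

Lemma limn_series_ord (u : nat -> R) n : (forall i, (n <= i)%N -> u i = 0) ->
  limn (series u) = \sum_(i < n) u i.
Proof.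
move=> u0; apply: lim_near_cst => //; exists n => // m /= nm.
rewrite /series /= (big_cat_nat (n := n)) //= [X in _ + X]big_nat_cond.
by rewrite [X in _ + X]big1 ?addr0 ?big_mkord // => i /andP[/andP[/u0]].
Qed.

Lemma csum_ord (z : nat -> R[i]) n : (forall i, (n <= i)%N -> z i = 0) ->
  csum z = \sum_(i < n) z i.
Proof.
move=> z0; apply: complexP => /=; rewrite (limn_series_ord (n := n)) //.
- by elim/big_rec2: _ => [|i a b _ ->]; rewrite ?ReD.
- by move=> i /z0 ->.
- by elim/big_rec2: _ => [//|i a b _ ->]; case: (z i) b => [? ?] [? ?].
- by move=> i /z0 ->.
Qed.

Lemma l2_summable (x : l2) : cvgn (series (fun i => sqmod (x i))).
Proof.
case: x => x /= /asboolP[_ [M HM]].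
apply: nondecreasing_is_cvgn.
  by apply: nondecreasing_series => i _ _; exact: sqmod_ge0.
by exists M => _ [n _ <-]; rewrite /series /= big_mkord.
Qed.

Definition l2ip (x y : l2) : R[i] := csum (fun i => x i * (y i)^*%C).

Lemma l2_csummable (x y : l2) : csummable (fun i => x i * (y i)^*%C).
Proof.
have cv := is_cvg_seriesD (@l2_summable x) (@l2_summable y).
apply: csummable_le cv => i; rewrite fctE; case: (x i) (y i) => [a b] [c d];
  rewrite /sqmod /= ler_norml; apply/andP; split;
  have := sqr_ge0 (a - c); have := sqr_ge0 (a + c);
  have := sqr_ge0 (b - d); have := sqr_ge0 (b + d);
  have := sqr_ge0 (a - d); have := sqr_ge0 (a + d);
  have := sqr_ge0 (b - c); have := sqr_ge0 (b + c); rewrite !expr2; lra.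
Qed.

Lemma sqnorm_l2 (x : l2) :
  sqnorm l2ip x = limn (series (fun i => sqmod (x i))).
Proof.
rewrite /sqnorm /l2ip /csum /=; congr (limn (series _)).
by apply/funext => i; rewrite sqmodE.
Qed.

Lemma sqnorm_l2_ge (x : l2) n : \sum_(i < n) sqmod (x i) <= sqnorm l2ip x.
Proof.
rewrite sqnorm_l2 -(big_mkord xpredT (fun i => sqmod (x i))).
apply: nondecreasing_cvgn_le (@l2_summable x) n.
by apply: nondecreasing_series => i _ _; exact: sqmod_ge0.
Qed.

Lemma sqnorm_l2_le (x : l2) M : (forall n, \sum_(i < n) sqmod (x i) <= M) ->
  sqnorm l2ip x <= M.
Proof.
move=> HM; rewrite sqnorm_l2; apply: limr_le; first exact: l2_summable.
by apply: nearW => n; rewrite /series /= big_mkord.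
Qed.

Lemma l2_sqmod_le (x : l2) i : sqmod (x i) <= sqnorm l2ip x.
Proof.
apply: le_trans (sqnorm_l2_ge x i.+1); rewrite big_ord_recr /=.
by rewrite lerDr sumr_ge0 // => j _; exact: sqmod_ge0.
Qed.

Lemma l2ipP : inner_product l2ip.
Proof.
have summ := l2_csummable.
have ip_sqmod x : l2ip x x = (sqnorm l2ip x)%:C.
  apply: complexP => //=; rewrite /l2ip /csum /=.
  rewrite [X in series X](_ : _ = fun=> 0).
    by rewrite (_ : series _ = fun=> 0) ?lim_cst //; apply/funext => n;
      rewrite /series /= big1.
  by apply/funext => i; rewrite sqmodE.
split.
- move=> a x y z; rewrite /l2ip -csumZ // -csumD //; last first.
    by have := summ (a *: x) z; congr csummable; apply/funext => i;
      rewrite l2Z mulrA.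
  by congr csum; apply/funext => i; rewrite l2D l2Z mulrDl mulrA.
- move=> x y; rewrite /l2ip -csum_conj //; congr csum; apply/funext => i.
  by rewrite conjcM conjcK mulrC.
- move=> x; rewrite ip_sqmod lecR; apply: le_trans (sqnorm_l2_ge x 0).
  by rewrite big_ord0.
- move=> x; rewrite ip_sqmod => -[x0]; apply: l2_eq => i; apply: sqmod_eq0.
  apply/eqP; rewrite eq_le sqmod_ge0 andbT -x0.
  exact: l2_sqmod_le.
Qed.

Lemma square_summable_ord (g : nat -> R[i]) N :
  (forall i, ~~ P i -> g i = 0) -> (forall i, (N <= i)%N -> g i = 0) ->
  square_summable g.
Proof.
move=> gP gN; split=> //; exists (\sum_(i < N) sqmod (g i)) => n.
apply: (@le_trans _ _ (\sum_(i < N + n) sqmod (g i))).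
  rewrite addnC big_split_ord /= lerDl.
  by apply: sumr_ge0 => i _; exact: sqmod_ge0.
rewrite big_split_ord /= [X in _ + X]big1 ?addr0 // => i _.
by rewrite gN ?leq_addr // /sqmod /= expr0n addr0.
Qed.

Lemma cauchy_real_cvg (v : nat -> R) :
  (forall e : R, 0 < e -> exists N, forall m n,
    (N <= m)%N -> (N <= n)%N -> (v m - v n) ^+ 2 < e) -> cvgn v.
Proof.
move=> Hv; apply: cauchy_cvg; apply: cauchy_exP => e e0.
have [N HN] := Hv _ (exprn_gt0 2 e0); exists (v N); exists N => // n /= Nn.
rewrite /ball /= -(@ltr_pXn2r _ 2) ?nnegrE ?normr_ge0 ?(ltW e0) //.
by rewrite real_normK ?num_real //; apply: HN.
Qed.

Lemma cvg_sum_ord (f : nat -> nat -> R) (l : nat -> R) n :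
  (forall i, f i @ \oo --> l i) ->
  (fun k => \sum_(i < n) f i k) @ \oo --> \sum_(i < n) l i.
Proof.
move=> fl; elim: n => [|n IHn].
  rewrite big_ord0 (_ : (fun k => _) = fun=> 0); first exact: cvg_cst.
  by apply/funext => k; rewrite big_ord0.
rewrite big_ord_recr (_ : (fun k => _) = fun k => \sum_(i < n) f i k + f n k).
  exact: cvgD.
by apply/funext => k; rewrite big_ord_recr.
Qed.

Lemma l2_complete : complete_space l2ip.
Proof.
move=> u cu.
have cvRe i : cvgn (fun n => complex.Re (u n i)).
  apply: cauchy_real_cvg => e /cu[N HN]; exists N => m n Nm Nn.
  apply: le_lt_trans (HN m n Nm Nn); apply: le_trans (l2_sqmod_le _ i).
  by rewrite l2B /sqmod ReD ReN lerDl sqr_ge0.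
have cvIm i : cvgn (fun n => complex.Im (u n i)).
  apply: cauchy_real_cvg => e /cu[N HN]; exists N => m n Nm Nn.
  apply: le_lt_trans (HN m n Nm Nn); apply: le_trans (l2_sqmod_le _ i).
  rewrite l2B /sqmod; case: (u m i) (u n i) => [a b] [c d] /=.
  by rewrite lerDr sqr_ge0.
pose z i := limn (fun n => complex.Re (u n i)) +i*
            limn (fun n => complex.Im (u n i)).
(* The Cauchy estimate passes to the coordinatewise limit in a sum over [K] coordinates, with [N]
   independent of [K]; it then gives both [z \in l2_pred] and convergence in norm. *)
have bound (e : R) : 0 < e -> exists N, forall m K, (N <= m)%N ->
    \sum_(i < K) sqmod (u m i - z i) <= e.
  move=> /cu[N HN]; exists N => m K Nm.
  have cvz i : (fun n => sqmod (u m i - u n i)) @ \oo --> sqmod (u m i - z i).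
    pose h (a : R[i]) p q := (complex.Re a - p) * (complex.Re a - p) +
                             (complex.Im a - q) * (complex.Im a - q).
    have hE (a b : R[i]) : sqmod (a - b) = h a (complex.Re b) (complex.Im b).
      by case: a b => [a a'] [b b'].
    have -> : (fun n => sqmod (u m i - u n i)) =
        (fun n => h (u m i) (complex.Re (u n i)) (complex.Im (u n i))).
      by apply/funext => n; exact: hE.
    rewrite hE /h.
    have cvp : (fun n => complex.Re (u m i) - complex.Re (u n i)) @ \oo -->
        complex.Re (u m i) - complex.Re (z i).
      by apply: cvgB (cvRe i); exact: cvg_cst.
    have cvq : (fun n => complex.Im (u m i) - complex.Im (u n i)) @ \oo -->
        complex.Im (u m i) - complex.Im (z i).
      by apply: cvgB (cvIm i); exact: cvg_cst.
    exact: (cvgD (cvgM cvp cvp) (cvgM cvq cvq)).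
  have cvS := @cvg_sum_ord _ _ K cvz.
  refine (cvgr_to_le cvS _).
  exists N => // n /= Nn; apply: le_trans (ltW (HN m n Nm Nn)).
  exact: (sqnorm_l2_ge (u m - u n)).
have zP : z \in l2_pred.
  apply/asboolP; split=> [i Pi|].
    apply: complexP => /=; apply: lim_near_cst => //; exists 0 => // n _;
      by rewrite l2_supp.
  have [N HN] := bound 1 ltr01.
  exists (2 * sqnorm l2ip (u N) + 2 * 1) => n.
  apply: (@le_trans _ _ (\sum_(i < n) (2 * sqmod (u N i) +
                                        2 * sqmod (u N i - z i)))).
    apply: ler_sum => i _; rewrite -[u N i - _]opprB sqmodN.
    by rewrite -{1}(subrK (u N i) (z i)) addrC; exact: sqmodD_le.
  rewrite big_split -!mulr_sumr; apply: lerD; rewrite ler_pM2l //.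
    exact: sqnorm_l2_ge.
  exact: HN.
exists (L2 zP) => e e0; have [N HN] := bound _ (divr_gt0 e0 (ltr0Sn _ 1)).
exists N => n Nn; apply: (@le_lt_trans _ _ (e / 2)); last by lra.
by apply: sqnorm_l2_le => K; exact: HN.
Qed.

Lemma rational_approx (z : R[i]) (e : R) : 0 < e -> exists q : rat * rat,
  sqmod (z - (ratr q.1 +i* ratr q.2)) < e.
Proof.
move=> e0; have h0 : 0 < Num.sqrt (e / 2) by rewrite sqrtr_gt0 divr_gt0.
have approx (r : R) : exists q : rat, (r - ratr q) ^+ 2 < e / 2.
  have /rat_in_itvoo[q] : r < r + Num.sqrt (e / 2) by rewrite ltrDl.
  rewrite inE /= => /andP[rq qr]; exists q.
  rewrite -sqrrN opprB -[ltRHS]sqr_sqrtr ?divr_ge0 ?ltW //.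
  by rewrite ltr_pXn2r ?nnegrE ?subr_ge0 ?ltW // ltrBlDl.
case: z => a b; have [p hp] := approx a; have [q hq] := approx b.
by exists (p, q); rewrite /sqmod /=; lra.
Qed.

(** An enumeration of the finite lists of rational pairs; a number that codes no list yields the
    empty one, hence the zero vector. *)
Definition rational_seq (n : nat) : seq (rat * rat) := odflt [::] (unpickle n).

Definition rational_coords n (i : nat) : R[i] :=
  if P i then ratr (nth (0, 0) (rational_seq n) i).1 +i*
              ratr (nth (0, 0) (rational_seq n) i).2 else 0.

Lemma rational_coordsP n : rational_coords n \in l2_pred.
Proof.
apply/asboolP/(@square_summable_ord _ (size (rational_seq n))) => i.
  by rewrite /rational_coords => /negbTE ->.
move=> ni; rewrite /rational_coords nth_default //=; case: ifP => // _.
by rewrite !rmorph0.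
Qed.

Lemma l2_separable : separable_space l2ip.
Proof.
exists (fun n => L2 (rational_coordsP n)) => x e e0.
have [K HK] : exists K, sqnorm l2ip x - e / 2 < \sum_(i < K) sqmod (x i).
  apply: contrapT => /forallNP H; have : sqnorm l2ip x <= sqnorm l2ip x - e / 2.
    by apply: sqnorm_l2_le => n; rewrite leNgt; apply/negP/H.
  by lra.
(* The first [K] coordinates cost at most [e / 4] and the tail at most [e / 2]; [K.+1] avoids a zero
   denominator. *)
have d0 : 0 < e / (4 * K.+1%:R) by rewrite divr_gt0 // mulr_gt0 // ltr0n.
have /choice[q qP] (i : nat) : exists q : rat * rat,
  sqmod (x i - (ratr q.1 +i* ratr q.2)) < e / (4 * K.+1%:R).
  exact: rational_approx.
exists (pickle (mkseq q K)); set d := L2 _.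
have dE i : d i = if P i then ratr (nth (0, 0) (mkseq q K) i).1 +i*
              ratr (nth (0, 0) (mkseq q K) i).2 else 0.
  by rewrite /d /= /rational_coords /rational_seq pickleK.
move: d dE => d dE.
apply: (@le_lt_trans _ _ (3 * e / 4)); last by lra.
apply: sqnorm_l2_le => n.
apply: (@le_trans _ _ (\sum_(i < K + n) sqmod ((x - d) i))).
  rewrite addnC big_split_ord /= lerDl.
  by apply: sumr_ge0 => i _; exact: sqmod_ge0.
rewrite big_split_ord /=.
have head : \sum_(i < K) sqmod (x i - d i) <= e / 4.
  apply: (@le_trans _ _ (\sum_(i < K) (e / (4 * K.+1%:R)))).
    apply: ler_sum => i _; rewrite dE nth_mkseq //; case: ifPn => Pi.
      exact/ltW/qP.
    by rewrite l2_supp // subr0 /sqmod /= expr0n addr0 ltW.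
  rewrite sumr_const card_ord -[leLHS]mulr_natl.
  have -> : e / 4 = K.+1%:R * (e / (4 * K.+1%:R)).
    by field; rewrite ?nat1r ?natr1 pnatr_eq0.
  by apply: ler_wpM2r; [exact: ltW | rewrite ler_nat].
have tail : \sum_(i < n) sqmod (x (K + i)%N - d (K + i)%N) =
    \sum_(i < K + n) sqmod (x i) - \sum_(i < K) sqmod (x i).
  rewrite big_split_ord /= [RHS]addrC addKr; apply: eq_bigr => i _.
  rewrite dE nth_default ?size_mkseq ?leq_addr //= !rmorph0.
  by rewrite (_ : (if _ then _ else _) = 0) ?subr0 //; case: ifP.
have := sqnorm_l2_ge x (K + n).
have -> : \sum_(i < K) sqmod ((x - d) i) = \sum_(i < K) sqmod (x i - d i).
  by [].
by rewrite tail; lra.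
Qed.

Lemma l2_hilbert : separable_hilbert l2ip.
Proof. by split; [exact: l2ipP | exact: l2_complete | exact: l2_separable]. Qed.

Lemma deltaP k : (fun i => (P i && (i == k))%:R) \in l2_pred.
Proof.
apply/asboolP/(@square_summable_ord _ k.+1) => i; first by move/negbTE ->.
by move=> ki; rewrite gtn_eqF // andbF.
Qed.

Definition delta k : l2 := L2 (deltaP k).

Lemma l2ip_delta (x : l2) k : l2ip x (delta k) = x k.
Proof.
rewrite /l2ip (@csum_ord _ k.+1) => [|i ki].
  rewrite big_ord_recr big1 /= => [|i _].
    rewrite eqxx andbT add0r conjc_nat; case: (boolP (P k)) => Pk.
      by rewrite mulr1.
    by rewrite l2_supp // mul0r.
  by rewrite (ltn_eqF (ltn_ord i)) andbF conjc0 mulr0.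
by rewrite /= gtn_eqF // andbF conjc0 mulr0.
Qed.

Lemma l2ip_delta2 j k : l2ip (delta j) (delta k) = (P k && (k == j))%:R.
Proof. exact: l2ip_delta. Qed.

End SquareSummable.

(** The coordinates form a matrix with [N.+1] rows and [N] columns, whose left kernel is nonzero;
    pairing the resulting relation with each [e j] kills every coefficient. *)
Lemma l2_dim_le (R : realType) N :
  ~ has_orthonormal (@l2ip R (fun i => (i < N)%N)) (fun=> True) N.+1.
Proof.
set P : pred nat := fun i => _; move=> [e [_ oe]]; have ipP := @l2ipP R P.
pose A : 'M[R[i]]_(N.+1, N) := \matrix_(i, j) e i j.
have : kermx A != 0.
  rewrite -mxrank_eq0 mxrank_ker -lt0n subn_gt0 ltnS.
  exact: rank_leq_col.
case/rowV0Pn => c /sub_kermxP cA /eqP; apply; apply/rowP => j; rewrite mxE.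
have ce : \sum_i c 0 i *: e i = 0.
  apply: l2_eq => k; rewrite -l2ip_delta (ip_suml ipP).
  have [kN|kN] := ltnP k N; last first.
    rewrite big1 ?l2_supp // -?leqNgt // => i _.
    by rewrite (ipZl ipP) l2ip_delta l2_supp -?leqNgt // mulr0.
  have := congr1 (fun M : 'rV__ => M 0 (Ordinal kN)) cA; rewrite !mxE => h.
  rewrite -[RHS]h; apply: eq_bigr => i _.
  by rewrite (ipZl ipP) l2ip_delta mxE.
have := congr1 (fun x => l2ip x (e j)) ce; rewrite (ip0l ipP) (ip_suml ipP).
rewrite (bigD1 j) //= (ipZl ipP) oe eqxx mulr1 big1 ?addr0 // => i ij.
by rewrite (ipZl ipP) oe (negbTE ij) mulr0.
Qed.

(** * Finite-rank partial isometries between orthonormal families *)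

Section FiniteRankPartialIsometry.
Variables (R : realType) (V : lmodType R[i]) (ip : V -> V -> R[i]).
Hypothesis ipP : inner_product ip.
Local Notation sq := (sqnorm ip).
Implicit Types (m n : nat) (P : pred nat) (a b : nat -> V).

Definition orthonormal_on P b : Prop :=
  forall i j, P i -> P j -> ip (b i) (b j) = (i == j)%:R.

Lemma orthonormal_on_sub P (Q : pred nat) b :
  (forall i, Q i -> P i) -> orthonormal_on P b -> orthonormal_on Q b.
Proof. by move=> QP ob i j /QP Pi /QP Pj; apply: ob. Qed.

(** For orthonormal families, the partial isometry with [a j |-> b j] for [j < m] that kills the
    complement of these [a j]; exchanging [a] and [b] gives the adjoint. *)
Definition transfer m a b (x : V) : V := \sum_(j < m) ip x (a j) *: b j.

Lemma transfer_linear m a b : linear_op (transfer m a b).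
Proof.
move=> c x y; rewrite /transfer scaler_sumr -big_split; apply: eq_bigr => j _.
by rewrite (ipDl ipP) (ipZl ipP) scalerDl scalerA.
Qed.

Lemma transfer_adjoint m a b : is_adjoint ip (transfer m a b) (transfer m b a).
Proof.
move=> x y; rewrite /transfer (ip_suml ipP) [RHS](ipC ipP) (ip_suml ipP).
rewrite raddf_sum /=; apply: eq_bigr => j _.
by rewrite -(ipC ipP) (ipZl ipP) (ipZr ipP) -(ipC ipP) mulrC.
Qed.

Section Orthonormal.
Variables (m : nat) (a b : nat -> V).
Hypotheses (oa : orthonormal_on (fun i => (i < m)%N) a)
           (ob : orthonormal_on (fun i => (i < m)%N) b).

Lemma ip_transfer x k : (k < m)%N -> ip (transfer m a b x) (b k) = ip x (a k).
Proof.
move=> km; rewrite (ip_suml ipP) (bigD1 (Ordinal km)) //= (ipZl ipP) ob //.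
rewrite eqxx mulr1 big1 ?addr0 // => i ik; rewrite (ipZl ipP) ob //.
by rewrite (_ : (i == k :> nat) = false) ?mulr0 //; apply: negbTE.
Qed.

Lemma transfer_basis k : (k < m)%N -> transfer m a b (a k) = b k.
Proof.
move=> km; rewrite /transfer (bigD1 (Ordinal km)) //= oa // eqxx scale1r.
rewrite big1 ?addr0 // => i ik; rewrite oa //.
by rewrite eq_sym (_ : (i == k :> nat) = false) ?scale0r //; apply: negbTE.
Qed.

Lemma transfer_comp x : transfer m b a (transfer m a b x) = transfer m a a x.
Proof. by apply: eq_bigr => j _; rewrite ip_transfer. Qed.

Lemma transfer_kernel x :
  kernel (transfer m a b) x <-> forall j, (j < m)%N -> ip x (a j) = 0.
Proof.
split=> [Tx j jm|xa].
  by rewrite -ip_transfer //; move: Tx; rewrite /kernel => ->; exact: ip0l.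
by rewrite /kernel /transfer big1 // => j _; rewrite xa // scale0r.
Qed.

End Orthonormal.

Lemma transfer_partial_isometry m a b :
  orthonormal_on (fun i => (i < m)%N) a -> orthonormal_on (fun i => (i < m)%N) b ->
  partial_isometry ip (transfer m a b) (transfer m b a).
Proof.
move=> oa ob; split=> [x|x y]; rewrite !transfer_comp //.
exact: transfer_adjoint.
Qed.

(** [|x - Tadj (T x)|^2 = |x|^2 - |T x|^2] is nonnegative. *)
Lemma partial_isometry_bounded (T Tadj : V -> V) : linear_op T ->
  is_adjoint ip T Tadj -> partial_isometry ip T Tadj -> bounded_op ip T.
Proof.
move=> linT adjT [idem self]; split=> //; exists 1 => x; rewrite mul1r.
have Px : ip x (Tadj (T x)) = (sq (T x))%:C by rewrite -adjT (ipE ipP).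
have sqP : sq (Tadj (T x)) = sq (T x) by rewrite /sqnorm self idem Px.
have := sqnorm_ge0 ipP (x - Tadj (T x)).
by rewrite (sqnormB ipP) Px sqP /=; lra.
Qed.

Lemma has_orthonormal_cat m n b (K : V -> Prop) :
  orthonormal_on (fun i => (i < m)%N) b ->
  (forall x, K x -> forall j, (j < m)%N -> ip x (b j) = 0) ->
  has_orthonormal ip K n -> has_orthonormal ip (fun=> True) (m + n).
Proof.
move=> ob Kb [e [Ke oe]].
exists (fun i : 'I_(m + n) =>
  match fintype.split i with inl j => b j | inr k => e k end).
split=> // i j; rewrite -{2}(splitK i) -{2}(splitK j).
case: (fintype.split i) (fintype.split j) => [i'|i'] [j'|j'] /=.
- by rewrite ob // eq_lshift.
- by rewrite eq_lrshift (ipC ipP) Kb // conjc0.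
- by rewrite eq_rlshift Kb.
- by rewrite oe eq_rshift.
Qed.

(** Indices for dimension [m + d]: the first [m] carry the rank, the others a kernel of dimension
    [d]. *)
Definition support m (d : hdim) : pred nat :=
  match d with Fin n => fun i => (i < m + n)%N | Inf => fun=> true end.

Lemma supportDl m d i : (i < m)%N -> support m d i.
Proof. by case: d => //= n im; apply: leq_trans im (leq_addr _ _). Qed.

Definition total_dim_le m d : Prop :=
  if d is Fin n then ~ has_orthonormal ip (fun=> True) (m + n).+1 else True.

(** The vectors [b (m + i)] give the lower bound; a longer orthonormal family in [K], joined to the
    first [m] vectors of [b], would exceed the dimension of the space. *)
Lemma dim_orthogonal_complement m d b (K : V -> Prop) :
  orthonormal_on (support m d) b ->
  total_dim_le m d ->
  (forall x, K x <-> forall j, (j < m)%N -> ip x (b j) = 0) ->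
  dim_is ip K d.
Proof.
move=> ob dimV KE.
have orthoK n : (forall i, (i < m + n)%N -> support m d i) ->
    has_orthonormal ip K n.
  move=> sub; exists (fun i : 'I_n => b (m + i)%N); split=> [i|i j].
    apply/KE => j jm; rewrite ob; last exact: supportDl.
      by rewrite gtn_eqF // ltn_addr.
    by apply: sub; rewrite ltn_add2l.
  by rewrite /= ob ?sub ?ltn_add2l ?eqn_add2l.
case: d ob dimV orthoK => [n|] ob dimV orthoK /=; last by move=> n; apply: orthoK.
split; first exact: orthoK.
move=> hK; apply: dimV; rewrite -addnS; apply: has_orthonormal_cat hK.
  by apply: orthonormal_on_sub ob => i im; apply: supportDl.
by move=> x /KE.
Qed.

(** The case [U = id] of [unitary_conjugation]. *)
Lemma conjugation_exists : complete_space ip -> exists C, conjugation ip C.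
Proof.
move=> complV.
have [C [Cc _ _]] := @unitary_conjugation _ _ _ ipP complV id id
  (fun _ _ _ => erefl) (fun _ _ _ => erefl) (fun=> erefl) (fun=> erefl)
  (fun _ _ => erefl) 0.
by exists C.
Qed.

End FiniteRankPartialIsometry.

Lemma l2_support_dim (R : realType) m d :
  total_dim_le (@l2ip R (support m d)) m d.
Proof. by case: d => // n; exact: l2_dim_le. Qed.

(** * A partial isometry that is not complex symmetric *)

Section NonComplexSymmetric.
Variables (R : realType) (V : lmodType R[i]) (ip : V -> V -> R[i]).
Hypothesis ipP : inner_product ip.
Local Notation sq := (sqnorm ip).
Variables (P : pred nat) (u : nat -> V).
Hypotheses (ou : orthonormal_on ip P u) (P5 : forall i, (i < 5)%N -> P i).

Let beta : R[i] := (3 / 5)%:C.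
Let gamma : R[i] := (4 / 5)%:C.

Lemma beta_gamma : beta * beta + gamma * gamma = 1.
Proof. by rewrite -!rmorphM -rmorphD /=; congr (_%:C); field. Qed.

(** Values 0 to 2 are the images under [T]. The others prolong them to an orthonormal family on the
    same index set, from which the dimension of [ker Tadj] is read off. *)
Definition rotated_basis (i : nat) : V :=
  match i with
  | 0 => u 1
  | 1 => beta *: u 2 + gamma *: u 3
  | 2 => u 4
  | 3 => u 0
  | 4 => gamma *: u 2 - beta *: u 3
  | k => u k
  end.

Lemma rotated_basis_orthonormal : orthonormal_on ip P rotated_basis.
Proof.
have ipu i j : P i -> P j -> ip (u i) (u j) = (i == j)%:R := @ou i j.
have conjb : beta^*%C = beta by exact: conjc_real.
have conjg : gamma^*%C = gamma by exact: conjc_real.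
have bg := beta_gamma.
have [P0 P1 P2] : [/\ P 0%N, P 1%N & P 2%N] by split; apply: P5.
have [P3 P4] : P 3 /\ P 4 by split; apply: P5.
case=> [|[|[|[|[|i]]]]] [|[|[|[|[|j]]]]] Pi Pj; rewrite /rotated_basis;
  rewrite ?(ipBl ipP, ipBr ipP, ipDl ipP, ipDr ipP, ipZl ipP, ipZr ipP);
  rewrite ?conjb ?conjg !ipu //= ?mulr0n ?mulr1n;
  rewrite ?(mulr0, mulr1, addr0, add0r, subr0, sub0r, mul0r, oppr0) //.
- by rewrite mulrC subrr.
- by rewrite mulrC subrr.
- by rewrite mulrN opprK addrC.
Qed.

Let T := transfer ip 3 u rotated_basis.
Let Tadj := transfer ip 3 rotated_basis u.

(* [T] maps [u_0 |-> u_1 |-> beta u_2 + gamma u_3] and [u_2 |-> u_4].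
   A conjugation [C] with [T = C T^* C] sends [u_4], which spans
   [ker T /\ ran T], to [ker T^* /\ ran T^*], spanned by [u_0]; yet
   [|T T u_0| = 1] while [|T^* T^* u_4| = beta]. *)
Lemma transfer_not_complex_symmetric : ~ complex_symmetric ip T Tadj.
Proof.
move=> [C [[linC isoC CK] TC]].
have ob := rotated_basis_orthonormal.
have lt3P i : (i < 3)%N -> P i by move=> i3; apply: P5; lia.
have ou3 := orthonormal_on_sub lt3P ou; have ob3 := orthonormal_on_sub lt3P ob.
have piT := transfer_partial_isometry ipP ou3 ob3.
have linT : linear_op T := transfer_linear ipP 3 u rotated_basis.
have adjT : is_adjoint ip T Tadj := transfer_adjoint ipP 3 u rotated_basis.
have C0 : C 0 = 0 := semilinear0 (conjc1 R) linC.
have TCx x : T (C x) = C (Tadj x) by rewrite TC CK.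
have CTx x : C (T x) = Tadj (C x) by rewrite TC CK.
have Tu4 : T (u 4) = 0.
  apply/(transfer_kernel ipP u ob3 _) => j j3; rewrite ou ?P5 //; last by lia.
  by rewrite gtn_eqF //; lia.
have Tu3 : T (u 3) = 0.
  apply/(transfer_kernel ipP u ob3 _) => j j3; rewrite ou ?P5 //; last by lia.
  by rewrite gtn_eqF.
have Tu k : (k < 3)%N -> T (u k) = rotated_basis k.
  by move=> k3; apply: transfer_basis.
pose x := C (u 4).
have T'x : Tadj x = 0 by rewrite /x -CTx Tu4 C0.
have xE : x = Tadj (C (u 2)) by rewrite -CTx Tu.
(* Being in the range of [Tadj], [x] is orthogonal to [u 3] in [ker T]; being in [ker Tadj], it is
   orthogonal to [u 1] and to [beta u_2 + gamma u_3], hence to [u 2] since [beta] is nonzero. *)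
have x3 : ip x (u 3) = 0.
  by rewrite xE (adjT' ipP adjT) Tu3 (ip0r ipP).
have xb := (transfer_kernel ipP rotated_basis ou3 _).1 T'x.
have x1 : ip x (u 1) = 0 by exact: (xb 0%N).
have x2 : ip x (u 2) = 0.
  have := xb 1%N erefl; rewrite /= (ipDr ipP) !(ipZr ipP) x3 mulr0 addr0.
  rewrite conjc_real => /eqP; rewrite mulf_eq0 => /orP[|/eqP //].
  by rewrite eq_complex /= eqxx andbT mulf_eq0 invr_eq0 !pnatr_eq0.
have Tx : T x = ip x (u 0%N) *: u 1.
  by rewrite /T /transfer !big_ord_recl big_ord0 /= x1 x2 !scale0r !addr0.
have squ k : P k -> sq (u k) = 1 by move=> Pk; rewrite /sqnorm ou // eqxx.
(* [T] is isometric on the range of [Tadj], which contains [x]. *)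
have sqx : sqmod (ip x (u 0%N)) = 1.
  have <- : sq (T x) = sqmod (ip x (u 0%N)).
    by rewrite Tx (sqnormZ ipP) squ ?mulr1 ?P5.
  rewrite /sqnorm adjT {2}xE (partial_isometry_adjTTT ipP linT adjT piT) -xE.
  by rewrite -/(sqnorm ip x) isoC squ ?P5.
have : sq (T (T x)) = 1.
  rewrite {1}Tx (linear_opZ _ _ linT) Tu // (sqnormZ ipP) sqx mul1r.
  by rewrite /sqnorm ob ?P5.
have -> : T (T x) = C (Tadj (Tadj (u 4))) by rewrite /x !TCx.
have -> : Tadj (u 4) = u 2 by exact: (transfer_basis (m := 3) u ob3 (k := 2)).
have -> : Tadj (u 2) = beta *: u 1.
  rewrite /Tadj /transfer !big_ord_recl big_ord0 /= (ipDr ipP) !(ipZr ipP).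
  rewrite !ou ?P5 //= !mulr0n mulr1n !mulr0 mulr1 !addr0 !scale0r add0r addr0.
  by congr (_ *: _); apply: complexP; rewrite /= ?oppr0.
rewrite isoC (sqnormZ ipP) squ ?P5 // /sqmod /= expr0n addr0 mulr1 => h.
have : (3 / 5 : R) ^+ 2 < 1 by rewrite expr2; lra.
by rewrite h ltxx.
Qed.

End NonComplexSymmetric.

Theorem theorem5p1 (R : realType) :
  (* (i) *)
  (forall (V : lmodType R[i]) (ip : V -> V -> R[i]) (T Tadj : V -> V),
     separable_hilbert ip -> bounded_op ip T -> is_adjoint ip T Tadj ->
     partial_isometry ip T Tadj ->
     forall d : hdim, dim_is ip (kernel T) d -> dim_is ip (kernel Tadj) d ->
     hdim_le1 d -> complex_symmetric ip T Tadj)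
  /\
  (* (ii) *)
  (forall (V : lmodType R[i]) (ip : V -> V -> R[i]) (T Tadj : V -> V),
     separable_hilbert ip -> bounded_op ip T -> is_adjoint ip T Tadj ->
     partial_isometry ip T Tadj ->
     forall d1 d2 : hdim, dim_is ip (kernel T) d1 -> dim_is ip (kernel Tadj) d2 ->
     d1 <> d2 -> ~ complex_symmetric ip T Tadj)
  /\
  (* (iii) *)
  (forall d : hdim, hdim_ge2 d ->
     (exists (V : lmodType R[i]) (ip : V -> V -> R[i]) (T Tadj : V -> V),
        [/\ separable_hilbert ip, bounded_op ip T, is_adjoint ip T Tadj,
            partial_isometry ip T Tadj &
         [/\ dim_is ip (kernel T) d, dim_is ip (kernel Tadj) d &
            complex_symmetric ip T Tadj]])
     /\
     (exists (V : lmodType R[i]) (ip : V -> V -> R[i]) (T Tadj : V -> V),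
        [/\ separable_hilbert ip, bounded_op ip T, is_adjoint ip T Tadj,
            partial_isometry ip T Tadj &
         [/\ dim_is ip (kernel T) d, dim_is ip (kernel Tadj) d &
            ~ complex_symmetric ip T Tadj]])).
Proof.
split; [|split].
- move=> V ip T Tadj [ipP complV _] [linT _] adjT pisoT d.
  exact: partial_isometry_complex_symmetric.
- move=> V ip T Tadj [ipP _ _] _ _ _ d1 d2 dT dTadj ne csT.
  exact/ne/(complex_symmetric_dim ipP csT).
- move=> d d2; split.
  (* The zero operator is the transfer of rank 0, on a space of dimension [d]; any conjugation works
     for it. *)
  + pose P := support 0 d; have ipP := @l2ipP R P; pose u := @delta R P.
    have ou : orthonormal_on (@l2ip R P) (fun i => (i < 0)%N) u by [].
    have ker K : (forall x, K x) -> dim_is (@l2ip R P) K d.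
      move=> Kx; apply: (@dim_orthogonal_complement _ _ _ ipP 0 d u) => //.
        by move=> i j _ Pj; rewrite l2ip_delta2 (Pj : P j = true) eq_sym.
      by rewrite /P; case: (d) => // n; exact: l2_dim_le.
    pose T := transfer (@l2ip R P) 0 u u.
    have linT : linear_op T := transfer_linear ipP 0 u u.
    have adjT : is_adjoint (@l2ip R P) T T := transfer_adjoint ipP 0 u u.
    have piT := transfer_partial_isometry ipP ou ou.
    have T0 x : T x = 0 by rewrite /T /transfer big_ord0.
    have [C Cc] := conjugation_exists ipP (@l2_complete R P).
    have [linC _ _] := Cc.
    exists (l2 R P), (@l2ip R P), T, T; split=> //; first exact: l2_hilbert.
      exact: partial_isometry_bounded adjT piT.
    split; [exact: ker | exact: ker | exists C; split=> // x].
    by rewrite !T0 (semilinear0 (conjc1 R) linC).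
  + pose P := support 3 d; have ipP := @l2ipP R P; pose u := @delta R P.
    have ou : orthonormal_on (@l2ip R P) P u.
      by move=> i j _ Pj; rewrite l2ip_delta2 (Pj : P j = true) eq_sym.
    (* The assumption that [d] is at least 2 enters here: rank 3 plus kernel 2 gives the five basis
       vectors. *)
    have P5 i : (i < 5)%N -> P i.
      by rewrite /P; case: (d) d2 => //= n n2 i5; lia.
    have ob := rotated_basis_orthonormal ipP ou P5.
    have sub i : (i < 3)%N -> P i := @supportDl 3 d i.
    have ou3 := orthonormal_on_sub sub ou; have ob3 := orthonormal_on_sub sub ob.
    have dimV : total_dim_le (@l2ip R P) 3 d := @l2_support_dim R 3 d.
    pose T := transfer (@l2ip R P) 3 u (rotated_basis u).
    pose Tadj := transfer (@l2ip R P) 3 (rotated_basis u) u.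
    have linT : linear_op T := transfer_linear ipP 3 u (rotated_basis u).
    have adjT : is_adjoint (@l2ip R P) T Tadj :=
      transfer_adjoint ipP 3 u (rotated_basis u).
    have piT := transfer_partial_isometry ipP ou3 ob3.
    exists (l2 R P), (@l2ip R P), T, Tadj; split=> //; first exact: l2_hilbert.
      exact: partial_isometry_bounded adjT piT.
    split.
    * apply: (dim_orthogonal_complement ipP ou dimV) => x.
      exact: (transfer_kernel ipP u ob3).
    * apply: (dim_orthogonal_complement ipP ob dimV) => x.
      exact: (transfer_kernel ipP (rotated_basis u) ou3).
    * exact: transfer_not_complex_symmetric ou P5.
Qed.
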